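(* Let $(X,d)$ be a proper geodesic metric space, $\bar\gamma:\mathbb R\to X$ a line, $b^+,b^-$ the associated Busemann functions, assume that $b^++b^-=0$ on all of $X$, and put $b:=b^+$. Then the following are true. (i) For every $a\in\mathbb R$ the function $ab$ is $c$-concave and fulfills $$(ab)^c=-ab-\frac{a^2}2,\qquad(-ab)^c=ab-\frac{a^2}2.$$ In particular, $(x,y)\in\partial^c(ab)$ if and only if $(y,x)\in\partial^c(-ab)$. (ii) $\operatorname{lip}(b)\equiv1$. (iii) For $a\in\mathbb R$ and $\gamma:[0,1]\to X$ the following are equivalent: (a) $\gamma$ is a constant speed geodesic and $\gamma_1\in\partial^c(ab)(\gamma_0)$; (b) $\gamma$ is a gradient flow trajectory of $ab$. In particular, if $\gamma:[0,1]\to X$ is a geodesic with $\gamma_1\in\partial^c(ab)(\gamma_0)$, then $\gamma_t\in\partial^c(tab)(\gamma_0)$ for all $t\in[0,1]$. (iv) For $a\in\mathbb R$ and $x,y\in X$: $$y\in\partial^c(ab)(x)\quad\Leftrightarrow\quad d(x,y)=|a|\ \text{ and }\ b(x)-b(y)=a.$$ (v) For $a_1,a_2\in\mathbb R$ with $a_1a_2\ge0$ and $x,y,z\in X$: $$y\in\partial^c(a_1b)(x),\ z\in\partial^c(a_2b)(y)\quad\Rightarrow\quad z\in\partial^c((a_1+a_2)b)(x).$$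
   Context: Metric spaces are complete and separable. Proper: bounded closed sets are compact. A (constant speed minimizing) geodesic is $\gamma:[0,1]\to X$ with $d(\gamma_t,\gamma_s)\le|t-s|\,d(\gamma_0,\gamma_1)$ for all $t,s$; the space is geodesic if any two points are joined by one. A line is $\bar\gamma:\mathbb R\to X$ with $d(\bar\gamma_t,\bar\gamma_s)=|t-s|$ for all $t,s\in\mathbb R$. Busemann functions: $b^+(x):=\lim_{t\to+\infty}\big(t-d(x,\bar\gamma_t)\big)$, $b^-(x):=\lim_{t\to+\infty}\big(t-d(x,\bar\gamma_{-t})\big)$ (the limits exist and are real valued). $c$-concavity is with respect to the cost $c=d^2/2$: for $\varphi:X\to\mathbb R$, $\varphi^c(y):=\inf_{x\in X}\frac{d^2(x,y)}2-\varphi(x)$; $\varphi$ is $c$-concave if $\varphi^{cc}=\varphi$; $\partial^c\varphi\subset X^2$ is the set of $(x,y)$ with $\varphi(x)+\varphi^c(y)=\frac{d^2(x,y)}2$, and $\partial^c\varphi(x)$ is the set of $y$ with $(x,y)\in\partial^c\varphi$. Local Lipschitz constant: $\operatorname{lip}(f)(x):=\limsup_{y\to x}\frac{|f(y)-f(x)|}{d(x,y)}$ ($0$ if $x$ is isolated). Gradient flow trajectory: let $f:X\to\mathbb R$ be Lipschitz and $I\subset\mathbb R$ a non-trivial interval. $\gamma:I\to X$ is a gradient flow trajectory of $f$ if for all $t<s$ in $I$ $$f(\gamma_t)=f(\gamma_s)+\frac12\int_t^s|\dot\gamma_r|^2\,dr+\frac12\int_t^s\operatorname{lip}(f)^2(\gamma_r)\,dr,$$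 where $|\dot\gamma_r|=\lim_{h\to0}d(\gamma_{r+h},\gamma_r)/|h|$ is the metric speed and $\int_t^s|\dot\gamma_r|^2dr:=+\infty$ if $\gamma$ is not absolutely continuous on $[t,s]$. *)

(* Defs.v *)
From HB Require Import structures.
From mathcomp Require Import all_boot all_order all_algebra.
From mathcomp Require Import all_classical all_reals all_analysis.

Set Implicit Arguments.
Unset Strict Implicit.
Unset Printing Implicit Defensive.

Import Order.TTheory GRing.Theory Num.Theory.
Import numFieldNormedType.Exports.

Local Open Scope classical_set_scope.
Local Open Scope ring_scope.

Section MetricSpaces.
Context {R : realType} {X : metricType R}.

Definition complete_space : Prop :=
  forall F : set_system X, ProperFilter F -> cauchy F -> exists x : X, F --> x.

Definition separable_space : Prop :=
  exists2 D : set X, countable D & dense D.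

Definition mbounded (A : set X) : Prop :=
  exists M : R, forall x y, A x -> A y -> mdist x y <= M.

Definition proper_space : Prop :=
  forall A : set X, closed A -> mbounded A -> compact A.

(* Curves on [0, 1], and more generally on an interval I, are represented by
   functions R -> X; every notion below depends only on their values on that
   interval. *)
Definition is_geodesic (gam : R -> X) : Prop :=
  forall t s, t \in `[0, 1] -> s \in `[0, 1] ->
    mdist (gam t) (gam s) <= `|t - s| * mdist (gam 0) (gam 1).

Definition geodesic_space : Prop :=
  forall x y : X, exists gam : R -> X,
    [/\ is_geodesic gam, gam 0 = x & gam 1 = y].

Definition is_line (gam : R -> X) : Prop :=
  forall t s, mdist (gam t) (gam s) = `|t - s|.

Definition busemann_plus (gam : R -> X) (x : X) : R :=
  lim ((t - mdist x (gam t)) @[t --> +oo]).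

Definition busemann_minus (gam : R -> X) (x : X) : R :=
  lim ((t - mdist x (gam (- t))) @[t --> +oo]).

Definition mlipschitz (f : X -> R) : Prop :=
  exists L : R, forall x y, `|f x - f y| <= L * mdist x y.

(* The case distinction is needed: at an isolated point x^' contains set0, which
   makes limf_esup equal to -oo. *)
Definition lip (f : X -> R) (x : X) : \bar R :=
  if `[< isolated [set: X] x >] then 0%E
  else limf_esup (fun y => (`|f y - f x| / mdist x y)%:E) x^'.

End MetricSpaces.

Arguments complete_space {R} X.
Arguments separable_space {R} X.
Arguments proper_space {R} X.
Arguments geodesic_space {R} X.

Section CConcavity.
Context {R : realType} {X : metricType R}.

Definition cost (x y : X) : R := mdist x y ^+ 2 / 2.

(* Extended real valued, since the infimum may be -oo; this also makes the
   transform iterable. *)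
Definition ctransform (phi : X -> \bar R) (y : X) : \bar R :=
  ereal_inf [set ((cost x y)%:E - phi x)%E | x in [set: X]].

Definition cconcave (phi : X -> R) : Prop :=
  ctransform (ctransform (EFin \o phi)) = EFin \o phi.

Definition csuperdiff (phi : X -> R) : set (X * X) :=
  [set p | ((phi p.1)%:E + ctransform (EFin \o phi) p.2 = (cost p.1 p.2)%:E)%E].

Definition csuperdiff_at (phi : X -> R) (x : X) : set X :=
  [set y | csuperdiff phi (x, y)].

End CConcavity.

Section GradientFlows.
Context {R : realType} {X : metricType R}.
Implicit Types (I : set R) (gam : R -> X) (f : X -> R) (t s : R).

Local Notation mu := (@lebesgue_measure R).

(* Absolute continuity of a metric space valued curve on [t, s], as usual in
   this setting: the distance is controlled by the integral of an L^1
   function. *)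
Definition abs_cont_curve gam t s : Prop :=
  exists2 g : R -> R, mu.-integrable `[t, s] (EFin \o g) &
    forall p q, t <= p -> p <= q -> q <= s ->
      ((mdist (gam p) (gam q))%:E <= \int[mu]_(r in `[p, q]) (g r)%:E)%E.

(* [lim] takes an arbitrary value where the limit does not exist; for an
   absolutely continuous curve this happens on a negligible set only. *)
Definition mspeed I gam (r : R) : R :=
  lim ((mdist (gam (r + h)) (gam r) / `|h|)
         @[h --> within [set h | I (r + h)] (0 : R)^']).

Definition kinetic_energy I gam t s : \bar R :=
  if `[< abs_cont_curve gam t s >]
  then (\int[mu]_(r in `[t, s]) ((mspeed I gam r) ^+ 2)%:E)%E
  else +oo%E.

Definition is_gradient_flow f I gam : Prop :=
  [/\ mlipschitz f,
      is_interval I,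
      (exists t s, [/\ I t, I s & t < s]) &
      forall t s, I t -> I s -> t < s ->
        (f (gam t))%:E =
        ((f (gam s))%:E + 2^-1%:E * kinetic_energy I gam t s
         + 2^-1%:E * \int[mu]_(r in `[t, s]) (lip f (gam r) ^+ 2))%E].

End GradientFlows.

(* Main.v *)
Require Import Defs.
From HB Require Import structures.
From mathcomp Require Import all_boot all_order all_algebra.
From mathcomp Require Import all_classical all_reals all_analysis.
From mathcomp Require Import measurable_realfun ring lra.

Set Implicit Arguments.
Unset Strict Implicit.
Unset Printing Implicit Defensive.

Import Order.TTheory GRing.Theory Num.Theory.
Import numFieldNormedType.Exports.

Local Open Scope classical_set_scope.
Local Open Scope ring_scope.

(** The proof rests on two features of the Busemann function [b]: it is
    1-Lipschitz, and from every point [b] can be increased or decreased at a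
    rate arbitrarily close to 1, over any prescribed distance ([unit_slope]).
    The increase comes from following a geodesic towards a far point of the
    line; the decrease is the same fact for the reversed line, since
    [b^- = - b].

    The statements on c-concavity follow by completing a square:
    [d ^+ 2 / 2 - `|a| * d >= - a ^+ 2 / 2], with equality exactly when
    [d = `|a|].  The Lipschitz bound makes this a lower bound in the infimum
    defining the c-transform of [a * b], and the unit slope makes it attained up
    to any error.  The equality case characterizes the c-superdifferential by
    [d(x, y) = `|a|] and [b x - b y = a] ([csuperdiff_slopeP]), from which
    additivity and the behaviour along geodesics are triangle inequalities.

    Geodesics in the c-superdifferential have constant speed [`|a|] and decrease
    [a * b] at the constant rate [a ^+ 2], which is the energy identity.  For the
    converse, let a piece of a gradient flow trajectory have duration [L], and
    let [d] be the distance between its endpoints.  Its kinetic energy is at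
    least [d ^+ 2 / L], so the energy identity and the Lipschitz bound give
    [`|a| * d >= d ^+ 2 / (2 * L) + a ^+ 2 * L / 2], that is
    [(d / L - `|a|) ^+ 2 <= 0].  Hence [d = `|a| * L] for every piece.

    The analytic content is the bound on the kinetic energy, which rests on the
    existence almost everywhere of the metric speed of an absolutely continuous
    curve, and on the fact that its integral controls the distances
    ([ae_metric_derivative]).  Both are reduced to real functions, the distances
    to the points of a dense sequence.  A real function with increments
    dominated by an integral has a density ([dominated_increments_density], by
    Radon-Nikodym applied to a Stieltjes measure), which is almost everywhere
    its derivative by the Lebesgue differentiation theorem. *)

(** * Busemann functions *)

Section Busemann.
Context {R : realType} {X : metricType R}.
Implicit Types (gam : R -> X) (x y : X).

(** Nondecreasing and bounded in [t], both by the triangle inequality. *)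
Lemma busemann_plus_cvg gam x : is_line gam ->
  (t - mdist x (gam t)) @[t --> +oo] -->
  sup (range (fun t : R => t - mdist x (gam t))).
Proof.
move=> line; apply: nondecreasing_cvgr.
- move=> s t st; have := metric_triangle x (gam s) (gam t).
  by rewrite line distrC ger0_norm ?subr_ge0//; lra.
- exists (mdist x (gam 0)) => _ [t _ <-].
  have := metric_triangle (gam 0) x (gam t); rewrite line sub0r normrN.
  by rewrite (metric_sym (gam 0)); have := ler_norm t; lra.
Qed.

Lemma busemann_plusE gam x : is_line gam ->
  busemann_plus gam x = sup (range (fun t : R => t - mdist x (gam t))).
Proof. by move=> line; apply: cvg_lim => //; exact: busemann_plus_cvg. Qed.

Lemma busemann_plus_ge gam x t : is_line gam ->
  t - mdist x (gam t) <= busemann_plus gam x.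
Proof.
move=> line; rewrite busemann_plusE//; apply: ub_le_sup; last by exists t.
exists (mdist x (gam 0)) => _ [s _ <-].
have := metric_triangle (gam 0) x (gam s); rewrite line sub0r normrN.
by rewrite (metric_sym (gam 0)); have := ler_norm s; lra.
Qed.

Lemma busemann_plus_approx gam x (T e : R) : is_line gam -> 0 < e ->
  exists2 t, T <= t & busemann_plus gam x - e < t - mdist x (gam t).
Proof.
move=> line e0; have := busemann_plus_cvg (x := x) line.
rewrite -busemann_plusE// => /cvgrPdist_lt/(_ e e0) near_b.
have [t [bt Tt]] :=
  filter_ex (filterI near_b (nbhs_pinfty_ge (num_real T))).
by exists t => //; move: bt; rewrite ltr_distlC => /andP[]; lra.
Qed.

Lemma busemann_plus_lipschitz gam x y : is_line gam ->
  `|busemann_plus gam x - busemann_plus gam y| <= mdist x y.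
Proof.
move=> line.
suff H u v : busemann_plus gam u - busemann_plus gam v <= mdist u v.
  by rewrite ler_norml; have := H x y; have := H y x; rewrite metric_sym; lra.
apply/ler_addgt0Pr => e e0.
have [t _ ut] := busemann_plus_approx u 0 line e0.
have := busemann_plus_ge v t line; have := metric_triangle v u (gam t).
by rewrite (metric_sym v u); lra.
Qed.

(** Following a minimizing geodesic from [x] towards a far point of the line
    increases the Busemann function almost at unit rate: on that geodesic the
    distance to the far point drops at unit rate. *)
Lemma busemann_plus_ascent gam x (r e : R) : geodesic_space X -> is_line gam ->
  0 <= r -> 0 < e ->
  exists2 y, mdist x y = r & busemann_plus gam x + r - e <= busemann_plus gam y.
Proof.
move=> geoX line r0 e0.
(* this choice of [t] makes the geodesic longer than [r] *)
have [t tT bt] :=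
  busemann_plus_approx x (busemann_plus gam x + r + 1) line e0.
have [sig [geo s0 s1]] := geoX x (gam t).
set D := mdist x (gam t) in bt *.
have rD : r < D by have := busemann_plus_ge x t line; rewrite -/D; lra.
have D0 : 0 < D by lra.
have rD01 : 0 <= r / D <= 1.
  apply/andP; split; first by rewrite divr_ge0// ltW.
  by rewrite ler_pdivrMr// mul1r ltW.
have i0 : (0 : R) \in `[0, 1] by rewrite in_itv/= lexx ler01.
have i1 : (1 : R) \in `[0, 1] by rewrite in_itv/= lexx ler01.
have ir : r / D \in `[0, 1] by rewrite in_itv.
have := geo 0 (r / D) i0 ir; have := geo (r / D) 1 ir i1.
rewrite s0 s1 -/D sub0r normrN [X in _ <= X * _]distrC.
rewrite !ger0_norm ?subr_ge0; last 2 first.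
  by case/andP: rD01.
  by case/andP: rD01.
rewrite mulrBl mul1r divfK ?gt_eqF// => far near_x.
have := metric_triangle x (sig (r / D)) (gam t); rewrite -/D => tri.
exists (sig (r / D)); first by apply/eqP; rewrite eq_le near_x; lra.
by have := busemann_plus_ge (sig (r / D)) t line; lra.
Qed.

(** Sharper than having Lipschitz constant 1: the extreme slopes [1] and [-1] are
    almost realized from every point and at every scale.  The sign of [a] selects
    the direction. *)
Definition unit_slope (b : X -> R) :=
  (forall x y, `|b x - b y| <= mdist x y) /\
  (forall x (a e : R), 0 < e ->
     exists2 y, mdist x y = `|a| & `|b y - (b x + a)| <= e).

(** The two Busemann functions being opposite, the ascent of [busemann_minus] is
    a descent of [busemann_plus]. *)
Lemma busemann_unit_slope gam : geodesic_space X -> is_line gam ->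
  (forall x, busemann_plus gam x + busemann_minus gam x = 0) ->
  unit_slope (busemann_plus gam).
Proof.
move=> geoX line bpm; split=> [x y|x a e e0].
  exact: busemann_plus_lipschitz.
have line_opp : is_line (fun t => gam (- t)).
  by move=> t s; rewrite line distrC opprK addrC.
have [a0|a0] := leP 0 a.
  have [y xy by_] := busemann_plus_ascent x geoX line a0 e0.
  exists y; first by rewrite ger0_norm.
  have := busemann_plus_lipschitz x y line; rewrite xy.
  by rewrite !ler_norml; lra.
have a0' : 0 <= - a by rewrite oppr_ge0 ltW.
have [y xy] := busemann_plus_ascent x geoX line_opp a0' e0.
(* [busemann_minus gam] is [busemann_plus] of the reversed line *)
change (busemann_minus gam x - a - e <= busemann_minus gam y -> exists2 y : X,
  mdist x y = `|a| & `|busemann_plus gam y - (busemann_plus gam x + a)| <= e).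
move=> by_.
exists y; first by rewrite ltr0_norm.
have := busemann_plus_lipschitz x y line; rewrite xy.
by have := bpm x; have := bpm y; rewrite !ler_norml; lra.
Qed.

End Busemann.

(** * c-concavity and slope of the multiples of a function of unit slope *)

Section UnitSlope.
Context {R : realType} {X : metricType R}.
Variable b : X -> R.
Hypothesis slope : unit_slope b.
Implicit Types (a k : R) (x y z : X).

Lemma unit_slope_lipschitz a x y :
  `|a * b x - a * b y| <= `|a| * mdist x y.
Proof. by rewrite -mulrBr normrM ler_wpM2l// slope.1. Qed.

(** The lower bound is the completed square, and the points given by
    [unit_slope] at distance [`|a|] from [y] attain it up to an arbitrarily small
    error.  The additive constant [k] allows for the transform to be iterated. *)
Lemma ctransform_affine a k y :
  ctransform (fun x => (a * b x + k)%:E) y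
  = (- (a * b y) - a ^+ 2 / 2 - k)%:E.
Proof.
apply/eqP; rewrite eq_le; apply/andP; split.
  apply/lee_addgt0Pr => e e0.
  have a1 : 0 < `|a| + 1 by rewrite ltr_wpDl.
  have [x yx bx] := slope.2 y a _ (divr_gt0 e0 a1).
  apply: le_trans (ereal_inf_lbound _) _; first by exists x.
  rewrite -EFinB -EFinD lee_fin /cost metric_sym yx real_normK ?num_real//.
  have : `|a * (b x - (b y + a))| <= e.
    rewrite normrM (le_trans (ler_wpM2l (normr_ge0 a) bx))//.
    by rewrite mulrCA ger_pMr// ler_pdivrMr// mul1r lerDl ler01.
  by rewrite ler_norml => /andP[+ _]; rewrite mulrBr mulrDr; lra.
apply: le_ereal_inf_tmp => _ [x _ <-].
rewrite -EFinB lee_fin /cost.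
have := unit_slope_lipschitz a x y; have := sqr_ge0 (mdist x y - `|a|).
rewrite sqrrB real_normK ?num_real// ler_norml -mulr_natl.
by move=> sq /andP[_ lip_]; lra.
Qed.

Lemma ctransform_slope a y :
  ctransform (fun x => (a * b x)%:E) y = (- (a * b y) - a ^+ 2 / 2)%:E.
Proof.
have -> : (fun x => (a * b x)%:E) = fun x => (a * b x + 0)%:E.
  by apply/funext => x; rewrite addr0.
by rewrite ctransform_affine subr0.
Qed.

Lemma cconcave_slope a : cconcave (fun x => a * b x).
Proof.
apply/funext => y /=.
have -> : ctransform (EFin \o (fun x => a * b x)) =
    fun x => (- a * b x + - (a ^+ 2 / 2))%:E.
  by apply/funext => x; rewrite [LHS]ctransform_slope mulNr.
by rewrite ctransform_affine; congr (_%:E); field.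
Qed.

(** Membership is equality in the completed square, which forces
    [mdist x y = `|a|]; the value of [b x - b y] can then be solved for, except
    for [a = 0] where [x = y]. *)
Lemma csuperdiff_slopeP a x y :
  csuperdiff (fun x => a * b x) (x, y) <-> mdist x y = `|a| /\ b x - b y = a.
Proof.
rewrite /csuperdiff/= [ctransform _ y]ctransform_slope -EFinD.
have sqa := real_normK (num_real a).
split=> [[]|[xy bxy]]; last first.
  by congr (_%:E); rewrite /cost xy sqa -[in RHS]bxy -[in LHS]bxy; field.
rewrite /cost => E; have := unit_slope_lipschitz a x y.
rewrite ler_norml => /andP[_ lip_].
have xy : mdist x y = `|a|.
  apply/eqP; rewrite -subr_eq0 -sqrf_eq0 eq_le sqr_ge0 andbT.
  by rewrite sqrrB sqa -mulr_natl; lra.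
split=> //; have [a0|a0] := eqVneq a 0.
  rewrite a0 normr0 in xy *.
  by rewrite (mdist_positivity _ _ xy) subrr.
apply: (mulfI a0); rewrite mulrBr -expr2.
by move: E; rewrite xy sqa; lra.
Qed.

(** Since [a1] and [a2] have the same sign, [`|a1| + `|a2|] is [`|a1 + a2|], which
    the total drop of [b] forces the distance from [x] to [z] to reach. *)
Lemma csuperdiff_slope_add a1 a2 x y z : 0 <= a1 * a2 ->
  csuperdiff (fun x => a1 * b x) (x, y) ->
  csuperdiff (fun x => a2 * b x) (y, z) ->
  csuperdiff (fun x => (a1 + a2) * b x) (x, z).
Proof.
move=> a12 /csuperdiff_slopeP[xy bxy] /csuperdiff_slopeP[yz byz].
have bxz : b x - b z = a1 + a2 by lra.
apply/csuperdiff_slopeP; split=> //; apply/eqP; rewrite eq_le.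
rewrite -{2}bxz slope.1 andbT (le_trans (metric_triangle x y z))// xy yz.
have [p1|n1] := leP 0 a1; have [p2|n2] := leP 0 a2.
- by rewrite !ger0_norm ?addr_ge0.
- have [->|p1'] := eqVneq a1 0; first by rewrite normr0 !add0r.
  by move: a12; rewrite pmulr_rge0 ?lt_neqAle 1?eq_sym ?p1'// leNgt n2.
- have [->|p2'] := eqVneq a2 0; first by rewrite normr0 !addr0.
  by move: a12; rewrite pmulr_lge0 ?lt_neqAle 1?eq_sym ?p2'// leNgt n1.
- by rewrite (ltr0_norm n1) (ltr0_norm n2) ltr0_norm; lra.
Qed.

(** At every small distance from [x] there are points realizing the slope up to
    an arbitrarily small error; in particular no point of [X] is isolated. *)
Lemma lip_slope a x : lip (fun x => a * b x) x = `|a|%:E.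
Proof.
have nearby (V : set X) e : nbhs x V -> 0 < e ->
    exists y, [/\ V y, y != x & 1 - e <= `|b y - b x| / mdist x y].
  move=> /nbhs_ballP[r /= r0 rV] e0.
  have r20 : 0 < r / 2 by rewrite divr_gt0.
  have [y xy] := slope.2 x (r / 2) _ (mulr_gt0 e0 r20).
  rewrite gtr0_norm// in xy => by_.
  exists y; split.
  - by apply: rV; rewrite ballEmdist/= xy ltr_pdivrMr// ltr_pMr// ltr1n.
  - by rewrite eq_sym -mdist_gt0 xy.
  rewrite xy ler_pdivlMr// (le_trans _ (ler_norm _))//.
  by move: by_; rewrite ler_norml; lra.
rewrite /lip; case: asboolP => [[_ [V xV Vx]]|_].
  have [y [Vy + _]] := nearby V 1 xV ltr01.
  by have := Vx; rewrite setIT => Vx'; move: Vy; rewrite Vx' => ->; rewrite eqxx.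
apply/eqP; rewrite eq_le; apply/andP; split.
  apply: le_trans (ereal_inf_lbound _) _.
    by exists [set y | y != x] => //; exact: (@nbhs_dnbhs_neq _ x).
  apply: ge_ereal_sup => _ [y yx <-]; rewrite lee_fin.
  rewrite ler_pdivrMr ?mdist_gt0 1?eq_sym// metric_sym.
  exact: unit_slope_lipschitz.
apply: le_ereal_inf_tmp => _ [V xV <-].
apply/lee_addgt0Pr => e e0.
have a1 : 0 < `|a| + 1 by rewrite ltr_wpDl.
have [y [Vy yx le1]] := nearby _ _ xV (divr_gt0 e0 a1).
rewrite -leeBlDr//; apply: le_trans (ereal_sup_ubound _); last first.
  by exists y => //; exact: Vy.
rewrite -EFinB lee_fin -mulrBr normrM -mulrA.
apply: le_trans (ler_wpM2l (normr_ge0 a) le1).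
rewrite mulrBr mulr1 lerD2l lerN2 mulrCA ger_pMr//.
by rewrite ler_pdivrMr// mul1r lerDl ler01.
Qed.

(** Over each of the three pieces cut by [t] and [s], the drop of [b] is bounded
    by the length of the piece, hence by its duration times [`|a|].  As the drops
    add up to [a], every one of these inequalities is an equality. *)
Lemma geodesic_slope a (gam : R -> X) :
  is_geodesic gam -> csuperdiff (fun x => a * b x) (gam 0, gam 1) ->
  forall t s : R, 0 <= t -> t <= s -> s <= 1 ->
  mdist (gam t) (gam s) = (s - t) * `|a| /\ b (gam t) - b (gam s) = (s - t) * a.
Proof.
move=> geo /csuperdiff_slopeP[d01 b01] t s t0 ts s1.
have i (u : R) : 0 <= u -> u <= 1 -> u \in `[0, 1].
  by move=> *; rewrite in_itv/=; apply/andP.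
have st0 : 0 <= s - t by rewrite subr_ge0.
have s0 := le_trans t0 ts; have t1 := le_trans ts s1.
have := geo t s (i _ t0 t1) (i _ s0 s1).
rewrite d01 distrC ger0_norm// => dts.
have := geo 0 t (i _ (lexx _) ler01) (i _ t0 t1).
rewrite d01 sub0r normrN ger0_norm// => d0t.
have := geo s 1 (i _ s0 s1) (i _ ler01 (lexx _)).
rewrite d01 distrC ger0_norm ?subr_ge0// => ds1.
have drop u v w : mdist u v <= w * `|a| ->
    b u - b v <= w * `|a| /\ - (w * `|a|) <= b u - b v.
  move=> uv; have := le_trans (slope.1 u v) uv.
  by rewrite ler_norml => /andP[].
have [p1 n1] := drop _ _ _ dts; have [p2 n2] := drop _ _ _ d0t.
have [p3 n3] := drop _ _ _ ds1.
have bts : b (gam t) - b (gam s) = (s - t) * a.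
  by have [a0|a0] := leP 0 a; move: p1 n1 p2 n2 p3 n3;
    [rewrite ger0_norm//|rewrite ltr0_norm//]; lra.
split=> //; apply/eqP; rewrite eq_le dts/= (le_trans _ (slope.1 _ _))//.
by rewrite bts normrM (ger0_norm st0).
Qed.

Lemma geodesic_slope_intermediate a (gam : R -> X) :
  is_geodesic gam -> csuperdiff (fun x => a * b x) (gam 0, gam 1) ->
  forall t : R, t \in `[0, 1] -> csuperdiff (fun x => t * a * b x) (gam 0, gam t).
Proof.
move=> geo sub t; rewrite in_itv/= => /andP[t0 t1].
have := geodesic_slope geo sub (lexx 0) t0 t1.
by rewrite subr0 => -[d0t b0t]; apply/csuperdiff_slopeP; rewrite normrM ger0_norm.
Qed.

End UnitSlope.

(** * Densities of real functions with dominated increments *)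

Section DominatedIncrements.
Context {R : realType}.
Local Notation mu := (@lebesgue_measure R).
Implicit Types (g k psi : R -> R) (p q x : R).

Lemma Rintegral_ocB g p q : mu.-integrable setT (EFin \o g) -> p <= q ->
  \int[mu]_(x in `]-oo, q]) g x - \int[mu]_(x in `]-oo, p]) g x
  = \int[mu]_(x in `]p, q]) g x.
Proof.
move=> gi pq; rewrite Rintegral_itvB ?bnd_simp//.
exact: integrableS gi.
Qed.

Lemma lebesgue_stieltjes_measure_oc (F : cumulative R R) p q : p <= q ->
  lebesgue_stieltjes_measure F `]p, q]%classic = (F q - F p)%:E.
Proof.
move=> pq; rewrite /lebesgue_stieltjes_measure /measure_extension.
by rewrite measurable_mu_extE/= ?wlength_itv_bnd//; exact: is_ocitv.
Qed.

(** A Stieltjes measure is determined by its values on half-open intervals. *)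
Lemma lebesgue_stieltjes_measure_density (F : cumulative R R) k :
  (forall x, 0 <= k x) -> mu.-integrable setT (EFin \o k) ->
  (forall p q, p <= q -> F q - F p = \int[mu]_(x in `]p, q]) k x) ->
  forall A, measurable A ->
  lebesgue_stieltjes_measure F A = (\int[mu]_(x in A) (k x)%:E)%E.
Proof.
move=> k0 ki FE A mA.
have pos E : (0 <= induced_charge ki E)%E.
  by apply: integral_ge0 => x _; rewrite lee_fin.
rewrite (@lebesgue_stieltjes_measure_unique _ F (measure_of_charge _ pos))//.
move=> _ [[p q] _ <-] /=; rewrite /measure_of_charge /induced_charge.
have [pq|qp] := leP p q; last first.
  by rewrite set_itv_ge ?bnd_simp -?leNgt ?ltW// measure0 integral_set0.
rewrite lebesgue_stieltjes_measure_oc// FE// /Rintegral fineK//.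
by apply: integrable_fin_num => //; exact: (integrableS measurableT _ _ ki).
Qed.

Lemma dominated_increments_continuous g psi :
  mu.-integrable setT (EFin \o g) ->
  (forall p q, p <= q -> `|psi q - psi p| <= \int[mu]_(x in `]p, q]) g x) ->
  continuous psi.
Proof.
move=> gi psig x; apply/cvgrPdist_lt => e e0.
have [d [d0 small]] := integral_normr_continuous gi e0.
have step p q : p <= q -> q - p < d -> `|psi q - psi p| < e.
  move=> pq qpd; apply: le_lt_trans (psig _ _ pq) _.
  apply: le_lt_trans (small `]p, q]%classic _ _) => //.
    apply: le_trans (ler_norm _) (le_normr_Rintegral _ _) => //.
    exact: integrableS gi.
  suff : (mu `]p, q] < d%:E)%E by [].
  rewrite lebesgue_measure_itv/= lte_fin.
  by case: ifPn => _; rewrite ?lte_fin// -EFinB lte_fin.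
near=> y.
have xyd : `|x - y| < d by near: y; exact: cvgr_dist_lt.
have [xy|yx] := leP x y.
  by rewrite distrC; apply: step => //; move: xyd; rewrite ler0_norm; lra.
by apply: step; [exact: ltW|move: xyd; rewrite gtr0_norm; lra].
Unshelve. all: by end_near. Qed.

(** Writing [G] for the primitive of [g], the functions [G + psi] and [G - psi]
    are nondecreasing, and the measures they generate add up to the measure of
    density [2 * g].  Hence each of the two is absolutely continuous, and the
    Radon-Nikodym density of the first one, minus [g], is the density of
    [psi]. *)
Lemma dominated_increments_density g psi :
  (forall x, 0 <= g x) -> mu.-integrable setT (EFin \o g) ->
  (forall p q, p <= q -> `|psi q - psi p| <= \int[mu]_(x in `]p, q]) g x) ->
  exists2 h : R -> R, mu.-integrable setT (EFin \o h) &
    forall p q, p <= q -> psi q - psi p = \int[mu]_(x in `]p, q]) h x.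
Proof.
move=> g0 gi psig.
pose G x := \int[mu]_(y in `]-oo, x]) g y.
have GE p q : p <= q -> G q - G p = \int[mu]_(x in `]p, q]) g x.
  exact: Rintegral_ocB.
have Gc : continuous G.
  apply: (dominated_increments_continuous gi) => p q pq.
  by rewrite GE// ger0_norm//; exact: Rintegral_ge0.
have psic := dominated_increments_continuous gi psig.
have nd1 : nondecreasing (G \+ psi).
  by move=> p q pq /=; have := psig _ _ pq; rewrite -GE// ler_norml; lra.
have nd2 : nondecreasing (G \- psi).
  by move=> p q pq /=; have := psig _ _ pq; rewrite -GE// ler_norml; lra.
have nd3 : nondecreasing (G \+ G).
  by move=> p q pq /=; have := psig _ _ pq; rewrite -GE// ler_norml; lra.
have c1 : right_continuous (G \+ psi).
  by apply: right_continuousW => x; apply: cvgD; [exact: Gc|exact: psic].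
have c2 : right_continuous (G \- psi).
  by apply: right_continuousW => x; apply: cvgB; [exact: Gc|exact: psic].
have c3 : right_continuous (G \+ G).
  by apply: right_continuousW => x; apply: cvgD; exact: Gc.
pose F1 : cumulative R R :=
  HB.pack (G \+ psi) (isCumulative.Build R _ R _ nd1 c1).
pose F2 : cumulative R R :=
  HB.pack (G \- psi) (isCumulative.Build R _ R _ nd2 c2).
pose F3 : cumulative R R :=
  HB.pack (G \+ G) (isCumulative.Build R _ R _ nd3 c3).
have ggi : mu.-integrable setT (EFin \o (g \+ g)).
  exact: (integrableD measurableT gi gi).
have F3E A : measurable A ->
    lebesgue_stieltjes_measure F3 A = (\int[mu]_(x in A) (g x + g x)%:E)%E.
  apply: lebesgue_stieltjes_measure_density => // [x|p q pq].
    by rewrite addr_ge0.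
  rewrite RintegralD//; [|exact: integrableS gi..].
  by rewrite -!GE//=; ring.
have F12 A : measurable A -> lebesgue_stieltjes_measure F3 A =
    (lebesgue_stieltjes_measure F1 A + lebesgue_stieltjes_measure F2 A)%E.
  pose nu12 : {measure set (measurableTypeR R) -> \bar R} :=
    measure_add (lebesgue_stieltjes_measure F1) (lebesgue_stieltjes_measure F2).
  have nu12E B : nu12 B =
    (lebesgue_stieltjes_measure F1 B + lebesgue_stieltjes_measure F2 B)%E.
    exact: measure_addE.
  move=> mA; rewrite (@lebesgue_stieltjes_measure_unique _ F3 nu12)//.
  move=> _ [[p q] _ <-] /=; rewrite nu12E.
  have [pq|qp] := leP p q; last first.
    by rewrite set_itv_ge ?bnd_simp -?leNgt ?ltW// !measure0 adde0.
  rewrite !lebesgue_stieltjes_measure_oc//= -EFinD.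
  by congr (_%:E); ring.
have F1le A : measurable A ->
    (lebesgue_stieltjes_measure F1 A <= \int[mu]_(x in A) (g x + g x)%:E)%E.
  by move=> mA; rewrite -F3E// F12// leeDl.
have F1oo : (lebesgue_stieltjes_measure F1 setT < +oo)%E.
  by apply: le_lt_trans (F1le _ measurableT) _; exact: integrable_lty.
(* a copy of the measure of [F1] that carries its finiteness *)
pose nu := mfrestr measurableT F1oo.
have nuE A : nu A = lebesgue_stieltjes_measure F1 A.
  by rewrite /nu /mfrestr /mrestr setIT.
have numu : nu `<< mu.
  apply/null_content_dominatesP => A mA muA.
  apply/eqP; rewrite eq_le measure_ge0 andbT nuE.
  apply: le_trans (F1le _ mA) _; rewrite null_set_integral//.
  exact: (measurable_int mu (integrableS measurableT mA (@subsetT _ A) ggi)).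
have [f [f0 ffin fi fE]] := radon_nikodym_sigma_finite numu.
have fK : EFin \o (fine \o f) = f by apply/funext => x /=; rewrite fineK.
have fi' : mu.-integrable setT (EFin \o (fine \o f)) by rewrite fK.
exists ((fine \o f) \- g); first exact: (integrableB measurableT fi' gi).
move=> p q pq.
rewrite RintegralB//; [|exact: integrableS fi'|exact: integrableS gi].
rewrite -GE// /Rintegral -/(EFin \o (fine \o f)) fK.
have := fE `]p, q]%classic (measurable_itv _).
rewrite [LHS]nuE lebesgue_stieltjes_measure_oc// => <- /=.
ring.
Qed.

End DominatedIncrements.

(** * Metric derivative of absolutely continuous curves *)

Section MetricDerivative.
Context {R : realType}.
Local Notation mu := (@lebesgue_measure R).

(** Lebesgue differentiation, in terms of absolute values of difference
    quotients. *)
Lemma ae_quotient_increments (psi h : R -> R) :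
  mu.-integrable setT (EFin \o h) ->
  (forall p q, p <= q -> psi q - psi p = \int[mu]_(x in `]p, q]) h x) ->
  {ae mu, forall x, `|psi (x + e) - psi x| / `|e| @[e --> 0^'] --> `|h x|}.
Proof.
move=> hi psiE.
pose F x := \int[mu]_(y in `]-oo, x]) h y.
have FE p q : psi q - psi p = F q - F p.
  have [pq|/ltW qp] := leP p q; first by rewrite psiE// -Rintegral_ocB.
  by rewrite -[LHS]opprB psiE// -Rintegral_ocB// opprB.
have hl : locally_integrable setT h.
  by apply: open_integrable_locally => //; exact: openT.
have : {ae mu, forall x, derivable F x 1 /\ F^`()%classic x = h x}.
  by apply: FTC1Ny => // y; exact: integrableS hi.
apply: filterS; first exact: (ae_filter_ringOfSetsType mu).
move=> x [dF]; rewrite derive1E => hE.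
have Fx : e^-1 *: ((F \o shift x) (e *: 1) - F x) @[e --> 0^'] --> h x.
  by rewrite -hE.
move/cvg_norm : Fx; apply: cvg_trans; apply: near_eq_cvg.
near=> e; rewrite /= FE /GRing.scale/= mulr1 normrM normfV mulrC.
by rewrite (addrC e x).
Unshelve. all: by end_near. Qed.

Context {X : metricType R}.

Lemma separable_dense_seq (x0 : X) : separable_space X ->
  exists u : nat -> X, forall x (e : R), 0 < e -> exists n, mdist x (u n) < e.
Proof.
case=> D cD dD.
have hit x (e : R) : 0 < e -> exists2 y, D y & mdist x y < e.
  move=> e0; have [y [xy Dy]] : (ball x e)° `&` D !=set0.
    apply: dD; last exact: open_interior.
    by exists x; exact: (nbhsx_ballx x e e0).
  by exists y => //; move/interior_subset: xy; rewrite ballEmdist.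
have [D0|/unsquash f] := pfcard_geP cD.
  by have [y] := hit x0 1 ltr01; rewrite D0.
exists f => x e /(hit x)[y Dy xy].
by have [n _ fn] := 'surj_f Dy; exists n; rewrite fn.
Qed.

Variables (c : R -> X) (g : R -> R).
Hypothesis g0 : forall x, 0 <= g x.
Hypothesis gi : mu.-integrable setT (EFin \o g).
Hypothesis cg : forall p q, p <= q ->
  mdist (c p) (c q) <= \int[mu]_(x in `]p, q]) g x.

(** The distances of the curve to the points of a dense sequence are real
    functions with increments dominated by [g], hence with densities [h n].
    The pointwise supremum of the [`|h n|] is the metric derivative: it bounds
    the difference quotients from above because it controls the distances by
    integration, and from below because each distance function is
    1-Lipschitz. *)
Lemma ae_metric_derivative : separable_space X ->
  exists m : R -> R,
  [/\ mu.-integrable setT (EFin \o m),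
      forall x, 0 <= m x,
      forall p q, p <= q -> mdist (c p) (c q) <= \int[mu]_(x in `]p, q]) m x &
      {ae mu, forall x,
         mdist (c (x + e)) (c x) / `|e| @[e --> 0^'] --> m x}].
Proof.
move=> /(separable_dense_seq (c 0))[u udense].
pose psi n r := mdist (c r) (u n).
have psi_lip n p q : `|psi n q - psi n p| <= mdist (c p) (c q).
  rewrite ler_norml /psi; have := metric_triangle (c p) (c q) (u n).
  have := metric_triangle (c q) (c p) (u n); rewrite (metric_sym (c q) (c p)).
  by lra.
have psig n p q : p <= q ->
    `|psi n q - psi n p| <= \int[mu]_(x in `]p, q]) g x.
  by move=> pq; apply: le_trans (psi_lip n p q) (cg pq).
have /choice[h hP] n : exists h : R -> R, mu.-integrable setT (EFin \o h) /\
    forall p q, p <= q -> psi n q - psi n p = \int[mu]_(x in `]p, q]) h x.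
  by have [h] := dominated_increments_density g0 gi (psig n); exists h.
(* [`|h n x| <= g x] holds only for almost every [x]; truncation makes it hold
   everywhere, so that the supremum is finite *)
pose k n (x : R) : R := Num.min `|h n x| (g x).
have k0 n x : 0 <= k n x by rewrite le_min normr_ge0 g0.
have kg n x : k n x <= g x by rewrite ge_min lexx orbT.
have kub x : has_ubound (range (k ^~ x)).
  by exists (g x) => _ [n _ <-].
pose m x := sups (k ^~ x) 0.
have km n x : k n x <= m x.
  apply: ub_le_sup; last by exists n.
  by exists (g x) => _ [j _ <-].
have mg x : m x <= g x.
  by apply: ge_sup => [|_ [n _ <-]//]; exists (k 0%N x); exists 0%N.
have mh n : measurable_fun setT (h n).
  by apply/measurable_EFinP; exact: measurable_int (hP n).1.
have mg' : measurable_fun setT g.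
  by apply/measurable_EFinP; exact: measurable_int gi.
have mnh n : measurable_fun setT (Num.norm \o h n) by exact: measurableT_comp.
have mk n : measurable_fun setT (k n).
  by apply: (measurable_minr (f := Num.norm \o h n)).
have mm : measurable_fun setT m by exact: measurable_fun_sups.
have m0 x : 0 <= m x by apply: le_trans (km 0%N x).
have ki n : mu.-integrable setT (EFin \o k n).
  apply: (le_integrable measurableT _ _ gi).
    by apply/measurable_EFinP; exact: mk.
  by move=> x _ /=; rewrite lee_fin !ger0_norm.
have mi : mu.-integrable setT (EFin \o m).
  apply: (le_integrable measurableT _ _ gi).
    by apply/measurable_EFinP; exact: mm.
  by move=> x _ /=; rewrite lee_fin !ger0_norm.
pose G x := \int[mu]_(y in `]-oo, x]) g y.
pose M x := \int[mu]_(y in `]-oo, x]) m y.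
have GE p q : p <= q -> G q - G p = \int[mu]_(x in `]p, q]) g x.
  exact: Rintegral_ocB.
have ME p q : p <= q -> M q - M p = \int[mu]_(x in `]p, q]) m x.
  exact: Rintegral_ocB.
have aeG := ae_quotient_increments gi GE.
have aeM := ae_quotient_increments mi ME.
have aeh : {ae mu, forall x, forall n,
    `|psi n (x + e) - psi n x| / `|e| @[e --> 0^'] --> `|h n x|}.
  by apply: ae_foralln => n; exact: ae_quotient_increments (hP n).1 (hP n).2.
have aeF := ae_filter_ringOfSetsType mu.
have aehk : {ae mu, forall x, forall n, `|h n x| = k n x}.
  apply: (@filterS _ _ aeF _ _ _ (@filterI _ _ aeF _ _ aeh aeG)).
  move=> x [hx gx] n; rewrite /k min_l//.
  rewrite -(ger0_norm (g0 x)); apply: (ler_cvg_to (hx n) gx).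
  near=> e; rewrite ler_wpM2r// ?invr_ge0//.
  have [xe|/ltW xe] := leP x (x + e).
    by rewrite GE// (le_trans (psig _ _ _ xe))// ler_norm.
  by rewrite distrC [leRHS]distrC GE// (le_trans (psig _ _ _ xe))// ler_norm.
have cm p q : p <= q -> mdist (c p) (c q) <= \int[mu]_(x in `]p, q]) m x.
  move=> pq; apply/ler_addgt0Pr => e e0.
  have [n pn] := udense (c p) (e / 2) (divr_gt0 e0 (ltr0Sn _ _)).
  have := metric_triangle (c p) (u n) (c q); rewrite (metric_sym (u n) (c q)).
  have : psi n q - psi n p <= \int[mu]_(x in `]p, q]) m x.
    rewrite (hP n).2//; apply: le_trans (ler_norm _) _.
    apply: le_trans (le_normr_Rintegral _ _) _ => //.
      by apply: integrableS (hP n).1.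
    apply: (@le_trans _ _ (\int[mu]_(x in `]p, q]) k n x)).
      rewrite le_eqVlt; apply/orP; left; apply/eqP; congr fine.
      apply: ae_eq_integral => //.
      - by apply/measurable_EFinP; exact: measurable_funTS (mnh n).
      - by apply/measurable_EFinP; exact: measurable_funTS (mk n).
      - by apply: (@filterS _ _ aeF _ _ _ aehk) => x hk _ /=; rewrite hk.
    apply: le_Rintegral => //; first exact: integrableS (ki n).
    exact: integrableS mi.
  by rewrite /psi; lra.
exists m; split=> //; apply: (@filterS _ _ aeF _ _ _
  (@filterI _ _ aeF _ _ aeh (@filterI _ _ aeF _ _ aeM aehk))).
move=> x [hx [mx hk]].
rewrite ger0_norm// in mx.
apply/cvgrPdist_lt => e e0.
have e20 : 0 < e / 2 by rewrite divr_gt0.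
have [_ [n _ <-]] : exists2 r,
    [set k n x | n in [set n | (0 <= n)%N]] r & m x - e / 2 < r.
  apply: sup_adherent => //; split; first by exists (k 0%N x); exists 0%N.
  by exists (g x) => _ [j _ <-].
rewrite -hk => kn.
near=> d.
have d0 : 0 < `|d| by rewrite normr_gt0; near: d; exact: nbhs_dnbhs_neq.
have ub : `|m x - `|M (x + d) - M x| / `|d| | < e.
  by near: d; move/cvgrPdist_lt : mx; exact.
have lb : `| `|h n x| - `|psi n (x + d) - psi n x| / `|d| | < e / 2.
  by near: d; move/cvgrPdist_lt : (hx n); exact.
have le1 : `|psi n (x + d) - psi n x| / `|d| <= mdist (c (x + d)) (c x) / `|d|.
  by rewrite ler_wpM2r ?invr_ge0// metric_sym.
have le2 : mdist (c (x + d)) (c x) / `|d| <= `|M (x + d) - M x| / `|d|.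
  rewrite ler_wpM2r ?invr_ge0//.
  have [xd|/ltW xd] := leP x (x + d).
    by rewrite metric_sym ME// (le_trans (cm _ _ xd))// ler_norm.
  by rewrite distrC ME// (le_trans (cm _ _ xd))// ler_norm.
by move: ub lb; rewrite !ltr_norml; lra.
Unshelve. all: by end_near. Qed.

End MetricDerivative.

(** * Lower bound on the kinetic energy *)

Section KineticEnergy.
Context {R : realType}.
Local Notation mu := (@lebesgue_measure R).

Import HBNNSimple.

(** The metric speed of a curve is known only almost everywhere, so that it need
    not be Borel measurable.  Its square can still be bounded below under the
    integral: the integral of a nonnegative function is a supremum over the
    simple functions below it, and as such is monotone for arbitrary
    functions. *)
Lemma ge0_le_lower_integral d (T : measurableType d)
    (nu : {measure set T -> \bar R}) (D : set T) (f1 f2 : T -> \bar R) :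
  (forall x, D x -> (0 <= f1 x)%E) -> (forall x, D x -> (f1 x <= f2 x)%E) ->
  (\int[nu]_(x in D) f1 x <= \int[nu]_(x in D) f2 x)%E.
Proof.
move=> f10 f12; have f20 x : D x -> (0 <= f2 x)%E.
  by move=> Dx; apply: le_trans (f10 x Dx) (f12 x Dx).
rewrite !ge0_integralE//; apply: ereal_sup_le => _ [h hf1 <-].
exists h => // x.
apply: le_trans (hf1 x) _; rewrite /patch; case: ifPn => // /set_mem.
exact: f12.
Qed.

Lemma integral_itv_cst (k p q : R) : p <= q ->
  (\int[mu]_(r in `[p, q]) k%:E = (k * (q - p))%:E)%E.
Proof.
move=> pq; rewrite integral_cst//= lebesgue_measure_itv/= lte_fin.
case: ltP => [_|qp]; first by rewrite -EFinB -EFinM.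
by rewrite mule0 (_ : q - p = 0) ?mulr0//; lra.
Qed.

Definition clamp (t s r : R) : R := Num.max t (Num.min s r).

Lemma clamp_itv t s r : t <= s -> t <= clamp t s r <= s.
Proof. by move=> ts; rewrite /clamp le_max lexx ge_max ts ge_min lexx. Qed.

Lemma clamp_id t s r : t <= r <= s -> clamp t s r = r.
Proof. by move=> /andP[tr rs]; rewrite /clamp (min_idPr rs) (max_idPr tr). Qed.

Lemma le_clamp t s p q : p <= q -> clamp t s p <= clamp t s q.
Proof.
move=> pq; rewrite /clamp ge_max !le_max lexx/=.
by apply/orP; right; rewrite le_min !ge_min lexx pq orbT.
Qed.

(** When clamping does not collapse [p] and [q], it can only move them towards
    each other. *)
Lemma clamp_lt t s p q : p <= q -> clamp t s p < clamp t s q ->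
  p <= clamp t s p /\ clamp t s q <= q.
Proof.
rewrite /clamp => pq lt_pq; split.
  rewrite le_max; apply/orP; right; rewrite le_min lexx andbT leNgt.
  apply/negP => /ltW sp; move: lt_pq.
  by rewrite (min_idPl sp) (min_idPl (le_trans sp pq)) ltxx.
rewrite ge_max ge_min lexx orbT andbT leNgt; apply/negP => qt.
move: lt_pq; rewrite [X in _ < X]max_l; last by rewrite ge_min (ltW qt) orbT.
by rewrite ltNge le_max lexx.
Qed.

Context {X : metricType R}.
Implicit Types gam : R -> X.

(** Clamping extends the curve by constants beyond the endpoints [t] and [s], so
    that the theory of curves defined on the whole line applies. *)
Lemma abs_cont_curve_clamp gam t s : t <= s -> abs_cont_curve gam t s ->
  exists g : R -> R, [/\ forall x, 0 <= g x, mu.-integrable setT (EFin \o g) &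
    forall p q, p <= q -> mdist (gam (clamp t s p)) (gam (clamp t s q))
                          <= \int[mu]_(x in `]p, q]) g x].
Proof.
move=> ts [g gi gamg].
pose g' := (Num.norm \o g) \_ `[t, s].
have g'0 x : 0 <= g' x by rewrite /g' /patch; case: ifPn => //= _.
have g'i : mu.-integrable setT (EFin \o g').
  rewrite /g' -restrict_EFin.
  apply/integrable_restrict => //=; rewrite setTI.
  exact: integrable_norm gi.
exists g'; split=> // p q pq.
have [/andP[tp ps] /andP[tq qs]] := (clamp_itv p ts, clamp_itv q ts).
have := le_clamp t s pq; rewrite le_eqVlt => /predU1P[->|pq'].
  by rewrite mdistxx; exact: Rintegral_ge0.
have [pp qq] := clamp_lt pq pq'.
rewrite -lee_fin; apply: le_trans (gamg _ _ tp (ltW pq') qs) _.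
have sub : `[clamp t s p, clamp t s q] `<=` `[t, s].
  by move=> x /=; rewrite !in_itv/= => /andP[px xq]; apply/andP; split; lra.
have gi' : mu.-integrable `[clamp t s p, clamp t s q] (EFin \o g).
  exact: integrableS gi.
have mng : measurable_fun `[clamp t s p, clamp t s q] (EFin \o (Num.norm \o g)).
  exact: measurable_int (integrable_norm gi').
apply: (@le_trans _ _ (\int[mu]_(x in `[clamp t s p, clamp t s q]) (`|g x|)%:E)%E).
  apply: le_integral => //; first exact: integrable_norm.
  by move=> x _; rewrite lee_fin ler_norm.
rewrite -integral_itv_obnd_cbnd; last first.
  by apply: measurable_funS mng => //; exact: subset_itv_oc_cc.
rewrite /Rintegral fineK; last first.
  by apply: integrable_fin_num => //; exact: integrableS g'i.
have -> : (\int[mu]_(x in `]clamp t s p, clamp t s q]) (`|g x|)%:E =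
           \int[mu]_(x in `]clamp t s p, clamp t s q]) (g' x)%:E)%E.
  apply: eq_integral => x; rewrite inE/= in_itv/= => /andP[px xq].
  by rewrite /g' patchE mem_set// /= in_itv/=; apply/andP; split; lra.
apply: ge0_subset_integral => //.
- by apply: measurable_funTS; exact: measurable_int g'i.
- by move=> x _; rewrite lee_fin.
- by move=> x /=; rewrite !in_itv/= => /andP[px xq]; apply/andP; split; lra.
Qed.

(** At an interior point every small increment stays in [I], and even in
    [`[t, s]], where any extension [c] of the curve has the same difference
    quotients. *)
Lemma mspeed_interior (I : set R) gam (c : R -> X) t s r (m : R) :
  `[t, s] `<=` I -> t < r < s ->
  (forall p, t <= p <= s -> c p = gam p) ->
  mdist (c (r + h)) (c r) / `|h| @[h --> 0^'] --> m ->
  mspeed I gam r = m.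
Proof.
move=> tsI /andP[tr rs] cgam cm.
have near_ts : \forall h \near (0 : R)^', t <= r + h <= s.
  have rt0 : 0 < r - t by rewrite subr_gt0.
  have sr0 : 0 < s - r by rewrite subr_gt0.
  near=> h.
  have h1 : `|h| <= r - t by near: h; exact: dnbhs0_le.
  have h2 : `|h| <= s - r by near: h; exact: dnbhs0_le.
  by move: h1 h2; rewrite !ler_norml; lra.
have nearI : \forall h \near (0 : R)^', I (r + h).
  by apply: filterS near_ts => h hts; apply: tsI; rewrite /= in_itv.
have withinE : within [set h | I (r + h)] (0 : R)^' = (0 : R)^'.
  apply/seteqP; split=> A; rewrite /within/=.
    by move=> HA; apply: filterS2 nearI HA => h Ih /(_ Ih).
  by apply: filterS => h.
rewrite /mspeed withinE; apply: cvg_lim => //.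
apply: cvg_trans cm; apply: near_eq_cvg; apply: filterS near_ts => h hts.
by rewrite !cgam//; apply/andP; split; lra.
Unshelve. all: by end_near. Qed.

(** Integrate [2 * k * m - k ^+ 2 <= m ^+ 2], where [m] is the metric derivative.
    For [k = mdist (gam t) (gam s) / (s - t)] the lower bound is
    [mdist (gam t) (gam s) ^+ 2 / (s - t)], as by the Cauchy-Schwarz
    inequality. *)
Lemma kinetic_energy_ge (I : set R) gam t s (k : R) : separable_space X ->
  `[t, s] `<=` I -> t < s -> 0 <= k ->
  ((2 * k * mdist (gam t) (gam s) - k ^+ 2 * (s - t))%:E
   <= kinetic_energy I gam t s)%E.
Proof.
move=> sepX tsI ts k0; rewrite /kinetic_energy.
case: asboolP => [ac|_]; last by rewrite leey.
have [g [g0 gi cg]] := abs_cont_curve_clamp (ltW ts) ac.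
have [m [mi m0 cm aem]] :=
  ae_metric_derivative (c := gam \o clamp t s) g0 gi cg sepX.
have mm : measurable_fun setT m.
  by apply/measurable_EFinP; exact: measurable_int mi.
have mm2 : measurable_fun setT (fun x => (m x ^+ 2)%:E).
  by apply/measurable_EFinP; exact: measurable_funX.
have le_energy : (\int[mu]_(r in `[t, s]) (m r ^+ 2)%:E <=
                  \int[mu]_(r in `[t, s]) (mspeed I gam r ^+ 2)%:E)%E.
  have [N [mN muN PN]] := aem.
  (* the endpoints are removed as well, to stay in the interior of [`[t, s]] *)
  pose N' := N `|` [set t; s].
  have mN' : measurable N' by apply: measurableU => //; exact: measurableU.
  have muN' : mu N' = 0%E.
    apply/negligibleP => //; apply: negligibleU; first exact/negligibleP.
    by apply: negligibleU; apply/negligibleP => //; exact: lebesgue_measure_set1.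
  rewrite (ge0_negligible_integral mN')//; last 2 first.
    exact: measurable_funTS.
    by move=> x _; rewrite lee_fin sqr_ge0.
  rewrite setDE integral_mkcondr; apply: ge0_le_lower_integral => r.
    by move=> _; rewrite /patch; case: ifPn => // _; rewrite lee_fin sqr_ge0.
  rewrite /= in_itv/= => /andP[tr rs]; rewrite /patch.
  case: ifPn => [/set_mem rN|_]; last by rewrite lee_fin sqr_ge0.
  have Nr : ~ N r by move=> Nr; apply: rN; left.
  rewrite (@mspeed_interior I gam (gam \o clamp t s) t s r (m r))//.
  - rewrite !lt_neqAle tr rs !andbT; apply/andP; split; apply/eqP => rE.
      by apply: rN; right; left.
    by apply: rN; right; right.
  - by move=> p tps /=; rewrite clamp_id.
  - by apply: contrapT => mr; apply: Nr; exact: PN.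
apply: le_trans le_energy.
rewrite EFinB leeBlDr//.
have -> : (k ^+ 2 * (s - t))%:E = (\int[mu]_(r in `[t, s]) (k ^+ 2)%:E)%E.
  by rewrite integral_itv_cst// ltW.
rewrite -ge0_integralD//; last 3 first.
- by move=> x _; rewrite lee_fin sqr_ge0.
- exact: measurable_funTS.
- by move=> x _; rewrite lee_fin sqr_ge0.
apply: (@le_trans _ _ (\int[mu]_(r in `[t, s]) (2 * k * m r)%:E)%E); last first.
  apply: ge0_le_integral => //.
  - by move=> x _; rewrite lee_fin !mulr_ge0.
  - by apply/measurable_EFinP; apply: measurable_funTS; exact: measurable_funM.
  - by apply: emeasurable_funD => //; exact: measurable_funTS.
  - move=> x _; rewrite -EFinD lee_fin.
    by have := sqr_ge0 (m x - k); rewrite sqrrB; lra.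
have mits : mu.-integrable `[t, s] (EFin \o m) by exact: integrableS mi.
have -> : (\int[mu]_(r in `[t, s]) (2 * k * m r)%:E =
           (2 * k * \int[mu]_(r in `[t, s]) m r)%:E)%E.
  rewrite -RintegralZl// /Rintegral fineK//.
  by apply: integrable_fin_num => //; exact: (integrableZl _ (2 * k) mits).
rewrite lee_fin ler_wpM2l ?mulr_ge0//.
have -> : \int[mu]_(r in `[t, s]) m r = \int[mu]_(r in `]t, s]) m r.
  by apply/esym/Rintegral_itv_obnd_cbnd; exact: integrableS mi.
by have := cm t s (ltW ts); rewrite /= !clamp_id// lexx ltW.
Qed.

End KineticEnergy.

(** * Gradient flow trajectories *)

Section GradientFlow.
Context {R : realType} {X : metricType R}.
Local Notation mu := (@lebesgue_measure R).
Variable b : X -> R.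
Hypothesis slope : unit_slope b.
Implicit Types (a : R) (gam : R -> X).

Lemma integral_lip_slope a gam (t s : R) : t < s ->
  (\int[mu]_(r in `[t, s]) (lip (fun x => (a * b x)%R) (gam r) ^+ 2) =
   (a ^+ 2 * (s - t))%:E)%E.
Proof.
move=> ts.
under eq_integral do rewrite lip_slope// -EFin_expe real_normK ?num_real//.
exact/integral_itv_cst/ltW.
Qed.

(** Each point of the unit interval can be moved by small nonzero amounts within
    it, to the right in the first half and to the left in the second one. *)
Lemma proper_within_unit_interval (r : R) : 0 <= r <= 1 ->
  ProperFilter (within [set h | `[0, 1]%classic (r + h)] (0 : R)^').
Proof.
move=> r01; split; last exact: within_filter.
rewrite /within/= => /nbhs_ballP[e /= e0 He].
have [h [h0 he hr]] : exists h, [/\ h != 0, `|h| < e & 0 <= r + h <= 1].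
  pose d := Num.min (e / 2) (1 / 2).
  have d0 : 0 < d by rewrite lt_min !divr_gt0.
  have de : d < e by rewrite gt_min ltr_pdivrMr// ltr_pMr// ltr1n.
  have d1 : d <= 1 / 2 by rewrite ge_min lexx orbT.
  have [r12|r12] := leP r (1 / 2).
    by exists d; rewrite gt_eqF// gtr0_norm//; split=> //; lra.
  by exists (- d); rewrite oppr_eq0 gt_eqF// normrN gtr0_norm//; split=> //; lra.
by apply: (He h) => //=; rewrite /ball/= sub0r normrN.
Qed.

(** Holds at the endpoints too: there the increments are one-sided, but the
    difference quotient is the constant [v]. *)
Lemma mspeed_geodesic gam (v r : R) : 0 <= r <= 1 ->
  (forall t s, 0 <= t -> t <= s -> s <= 1 ->
     mdist (gam t) (gam s) = (s - t) * v) ->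
  mspeed `[0, 1]%classic gam r = v.
Proof.
move=> r01 gamv; rewrite /mspeed.
have FF := proper_within_unit_interval r01.
apply: cvg_lim => //; apply: cvg_near_cst.
rewrite near_withinE; near=> h => /=.
have h0 : h != 0 by near: h; exact: nbhs_dnbhs_neq.
rewrite in_itv/= => /andP[h1 h2]; case/andP: r01 => r0 r1.
have nh : `|h| != 0 by rewrite normr_eq0.
have [hp|hn] := leP 0 h.
  by rewrite metric_sym gamv//; [rewrite ger0_norm//; field|lra].
by rewrite gamv//; [rewrite ltr0_norm//; field|lra].
Unshelve. all: by end_near. Qed.

Lemma geodesic_gradient_flow a gam : is_geodesic gam ->
  csuperdiff (fun x => a * b x) (gam 0, gam 1) ->
  is_gradient_flow (fun x => a * b x) `[0, 1]%classic gam.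
Proof.
move=> geo sub; have gs := geodesic_slope slope geo sub.
have gd t s t0 ts s1 := (gs t s t0 ts s1).1.
split.
- by exists `|a| => x y; exact: unit_slope_lipschitz.
- exact: interval_is_interval.
- by exists 0, 1; rewrite /= !in_itv/= !lexx !ler01 ltr01.
move=> t s; rewrite /= !in_itv/= => /andP[t0 t1] /andP[s0 s1] ts.
have intv : (\int[mu]_(r in `[t, s]) (`|a| ^+ 2)%:E = (a ^+ 2 * (s - t))%:E)%E.
  by rewrite integral_itv_cst ?ltW// real_normK ?num_real.
have ac : abs_cont_curve gam t s.
  exists (cst `|a|).
    apply/integrableP; split; first exact/measurable_EFinP/measurable_cst.
    under eq_integral do rewrite /= normr_id.
    by rewrite integral_itv_cst ?ltW// ltry.
  move=> p q tp pq qs; rewrite [leRHS](integral_itv_cst `|a| pq) lee_fin.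
  by rewrite (gd p q (le_trans t0 tp) pq (le_trans qs s1)) mulrC.
have -> : kinetic_energy `[0, 1]%classic gam t s = (a ^+ 2 * (s - t))%:E.
  rewrite /kinetic_energy; case: asboolP => // _; rewrite -intv.
  apply: eq_integral => r; rewrite inE/= in_itv/= => /andP[tr rs].
  by rewrite (@mspeed_geodesic _ `|a|)//; apply/andP; split; lra.
rewrite integral_lip_slope// -!EFinM -!EFinD; congr (_%:E).
have : a * (b (gam t) - b (gam s)) = a * ((s - t) * a).
  by rewrite (gs t s t0 (ltW ts) s1).2.
by rewrite mulrBr => ?; rewrite -[LHS](subrK (a * b (gam s))); lra.
Qed.

(** With the mean speed [k] of the piece, the energy identity and the Lipschitz
    bound combine to [(k - `|a|) ^+ 2 <= 0]. *)
Lemma gradient_flow_speed a gam (t s : R) : separable_space X ->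
  is_gradient_flow (fun x => a * b x) `[0, 1]%classic gam ->
  0 <= t -> t < s -> s <= 1 ->
  mdist (gam t) (gam s) = `|a| * (s - t) /\
  a ^+ 2 * (s - t) <= a * b (gam t) - a * b (gam s).
Proof.
move=> sepX [_ _ _ flow] t0 ts s1.
have L0 : 0 < s - t by rewrite subr_gt0.
pose k := mdist (gam t) (gam s) / (s - t).
have dE : mdist (gam t) (gam s) = k * (s - t) by rewrite divfK ?gt_eqF.
have k0 : 0 <= k by rewrite divr_ge0 ?mdist_ge0// ltW.
have tsI : `[t, s] `<=` `[0, 1]%classic.
  by move=> r /=; rewrite !in_itv/= => /andP[? ?]; apply/andP; split; lra.
have := kinetic_energy_ge gam sepX tsI ts k0.
have := flow t s; rewrite /= !in_itv/= => flow_ts.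
have {flow_ts} := flow_ts _ _ ts.
rewrite integral_lip_slope//.
have : `|a * b (gam t) - a * b (gam s)| <= `|a| * mdist (gam t) (gam s).
  exact: unit_slope_lipschitz.
rewrite ler_norml => /andP[_ lip_].
have t01 : 0 <= t <= 1 by apply/andP; split; lra.
have s01 : 0 <= s <= 1 by apply/andP; split; lra.
case: kinetic_energy => [K| |] //; last first.
  by move=> /(_ t01 s01); rewrite gt0_muley// lte_fin.
move=> /(_ t01 s01); rewrite -!EFinM -!EFinD lee_fin => -[bE] KE.
have ka : k = `|a|.
  apply/eqP; rewrite -subr_eq0 -sqrf_eq0 eq_le sqr_ge0 andbT.
  rewrite -(pmulr_lle0 _ L0) sqrrB real_normK ?num_real//.
  by move: KE lip_; rewrite dE -mulr_natl; nra.
rewrite dE ka; split=> //.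
by move: KE; rewrite dE ka bE -(real_normK (num_real a)); nra.
Qed.

Lemma gradient_flow_geodesic a gam : separable_space X ->
  is_gradient_flow (fun x => a * b x) `[0, 1]%classic gam ->
  is_geodesic gam /\ csuperdiff (fun x => a * b x) (gam 0, gam 1).
Proof.
move=> sepX flow.
have speed t s := gradient_flow_speed (t := t) (s := s) sepX flow.
have [d01 b01] := speed 0 1 (lexx 0) ltr01 (lexx 1).
rewrite subr0 mulr1 in d01; rewrite subr0 mulr1 in b01; split.
  move=> t s; rewrite !in_itv/= => /andP[t0 t1] /andP[s0 s1].
  rewrite d01 mulrC; have [ts|st|->] := ltgtP t s.
  - by rewrite (speed t s t0 ts s1).1 distrC (@gtr0_norm _ (s - t)) ?subr_gt0.
  - by rewrite metric_sym (speed s t s0 st t1).1 (@gtr0_norm _ (t - s)) ?subr_gt0.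
  - by rewrite mdistxx subrr normr0 mulr0.
apply/(csuperdiff_slopeP slope); split=> //.
have [a0|a0] := eqVneq a 0.
  by rewrite a0 normr0 in d01 *; rewrite (mdist_positivity _ _ d01) subrr.
apply: (mulfI a0); apply/eqP; rewrite eq_le mulrBr -expr2 b01 andbT.
have := unit_slope_lipschitz slope a (gam 0) (gam 1).
by rewrite d01 -expr2 real_normK ?num_real// ler_norml => /andP[].
Qed.

End GradientFlow.

Theorem theorem2p3 (R : realType) (X : metricType R)
    (Xcomplete : complete_space X) (Xseparable : separable_space X)
    (Xproper : proper_space X) (Xgeodesic : geodesic_space X)
    (bgam : R -> X) (bgam_line : is_line bgam)
    (bpm : forall x : X, busemann_plus bgam x + busemann_minus bgam x = 0) :
  let b := busemann_plus bgam in
  let mulb (a : R) : X -> R := fun x => a * b x in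
  (* (i) *)
  [/\ (forall a : R,
        [/\ cconcave (mulb a),
            (forall y : X, ctransform (EFin \o mulb a) y
                           = (- (a * b y) - a ^+ 2 / 2)%:E),
            (forall y : X, ctransform (EFin \o (fun x => - (a * b x))) y
                           = (a * b y - a ^+ 2 / 2)%:E) &
            (forall x y : X, csuperdiff (mulb a) (x, y) <->
                             csuperdiff (fun x => - (a * b x)) (y, x))]),
  (* (ii) *)
      (forall x : X, lip b x = 1%E),
  (* (iii) *)
      ((forall (a : R) (gam : R -> X),
         (is_geodesic gam /\ csuperdiff_at (mulb a) (gam 0) (gam 1)) <->
         is_gradient_flow (mulb a) `[0, 1] gam) /\
       (forall (a : R) (gam : R -> X),
         is_geodesic gam -> csuperdiff_at (mulb a) (gam 0) (gam 1) ->
         forall t : R, t \in `[0, 1] ->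
           csuperdiff_at (mulb (t * a)) (gam 0) (gam t))),
  (* (iv) *)
      (forall (a : R) (x y : X),
         csuperdiff_at (mulb a) x y <-> mdist x y = `|a| /\ b x - b y = a) &
  (* (v) *)
      (forall (a1 a2 : R) (x y z : X), 0 <= a1 * a2 ->
         csuperdiff_at (mulb a1) x y -> csuperdiff_at (mulb a2) y z ->
         csuperdiff_at (mulb (a1 + a2)) x z)].
Proof.
move=> b mulb.
have slope : unit_slope b by exact: busemann_unit_slope.
have oppE (a : R) : (fun x => - (a * b x)) = (fun x => - a * b x).
  by apply/funext => x; rewrite mulNr.
split.
- move=> a; split.
  + exact: cconcave_slope.
  + exact: ctransform_slope.
  + by move=> y; rewrite oppE [LHS](ctransform_slope slope) mulNr opprK sqrrN.
  + move=> x y; rewrite oppE.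
    split=> /(csuperdiff_slopeP slope)[d_eq b_eq];
      by apply/(csuperdiff_slopeP slope); rewrite normrN metric_sym in d_eq *;
        split=> //; lra.
- move=> x; have := lip_slope slope 1 x; rewrite normr1 => <-.
  by congr lip; apply/funext => y; rewrite mul1r.
- split=> a gam.
    split=> [[geo sub]|flow]; first exact: geodesic_gradient_flow.
    exact: gradient_flow_geodesic.
  exact: geodesic_slope_intermediate.
- by move=> a x y; exact: csuperdiff_slopeP.
- by move=> a1 a2 x y z; exact: csuperdiff_slope_add.
Qed.
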